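(* Let $G$ be a finite abelian group and let $S\subseteq G$ with $0\in S$ be a generating, $2$-separable subset of $G$ such that $|S|\ge 3$ and $m:=\kappa_2(S)-|S|\le 4$. Let $A$ be a $2$-atom of $S$ with $0\in A$. If $|S|<|G|-\binom{m+4}{2}$, then either $|A|=2$ or $A$ is a subgroup of $G$.
   Context: For a subset $S$ of a finite abelian group with $0\in S$, $\langle S\rangle$ denotes the subgroup generated by $S$. For a positive integer $k$, $S$ is called $k$-separable if there exists $X\subseteq\langle S\rangle$ with $|X|\ge k$ and $|X+S|\le|\langle S\rangle|-k$. If $S$ is $k$-separable, its $k$-th isoperimetric number is $\kappa_k(S)=\min\{|X+S|-|X| : X\subseteq\langle S\rangle,\ |X|\ge k,\ |X+S|\le|\langle S\rangle|-k\}$. A set $X$ attaining this minimum is a $k$-fragment of $S$, and a $k$-fragment of minimum cardinality is a $k$-atom of $S$. *)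

(* Defs.v *)
From mathcomp Require Import all_boot all_order all_fingroup all_algebra.

Set Implicit Arguments.
Unset Strict Implicit.
Unset Printing Implicit Defensive.

Local Open Scope group_scope.

(* Finite abelian groups are written multiplicatively, as in fingroup: 0 is 1,
   X + S is the pointwise product X * S, and the subgroup generated by S is
   <<S>>. *)

Section Isoperimetry.

Variable gT : finGroupType.
Implicit Types (k : nat) (S X A : {set gT}).

(* |X + S| <= |<S>| - k is written without a subtraction, because the
   subtraction of nat is truncated. *)
Definition admissible k S : {set {set gT}} :=
  [set X : {set gT} |
     [&& X \subset <<S>>, k <= #|X| & #|X * S| + k <= #|<<S>>|]].

Definition separable k S : bool := [exists X, X \in admissible k S].

(* |X + S| - |X|; the subtraction is exact as soon as S is nonempty. *)
Definition excess S X : nat := #|X * S| - #|X|.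

(* The neutral element #|<<S>>| bounds excess S X for every X in
   admissible k S, so when S is k-separable this is the true minimum. *)
Definition kappa k S : nat :=
  \big[minn/#|<<S>>|]_(X in admissible k S) excess S X.

Definition fragment k S X : bool :=
  (X \in admissible k S) && (excess S X == kappa k S).

Definition atom k S A : bool :=
  fragment k S A && [forall X, fragment k S X ==> (#|A| <= #|X|)].

End Isoperimetry.

(* The binomial coefficient with an integer upper index n, set to 0 for n < 0.
   The polynomial convention gives n(n-1)/2 > 0 for n < 0 and k = 2, so as the
   subtracted term in an upper bound on |S| the value 0 makes the hypothesis
   weakest: a theorem proved with binz holds under either convention. *)
Definition binz (n : int) (k : nat) : nat :=
  if n is Posz p then 'C(p, k) else 0.

(* Main.v *)
Require Import Defs.
From mathcomp Require Import all_boot all_order all_fingroup all_algebra.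
From mathcomp Require Import zify.

(** Suppose |A| >= 3 and A is not a subgroup; put T = G \ AS and H = <<A>>.
    The set T is a fragment of S^-1 with |G| - |T S^-1| = |A|, and the
    translates of A^-1 are the atoms of S^-1, so the intersection property of
    atoms applies: a translate of A^-1 with two points in T lies in T.  Fix
    x <> 1 in A and cut T into d maximal chains p, px, px^2, ...  Then a chain
    of length n + 1 has next to it, shifted by x y^-1, a maximal chain of
    length exactly n.  If T contains no coset of H, this gives
    |T| <= 'C(d + 1, 2), hence a chain reduced to one point p, and the points
    p y^-1 of T A^-1 lie outside T and T x^-1.  As T A^-1 is disjoint from S,
    this forces d <= m + 2, and T is too small.

    If T contains a coset of H, then H itself is admissible, and the minimality
    of kappa bounds |H| by |A| + t, where t = |SH \ AS|.  Let W = SH \ S.  For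
    h <> 1 in H the pair {1, h} is not a fragment, so |W :&: Wh| is at most
    t + |A| - 3, whereas the sum of |W :&: Wh| over H is the sum of |W :&: C|^2
    over the cosets C of H in SH.  The chain estimates inside each coset and
    m <= 4 contradict these bounds. *)

Set Implicit Arguments.
Unset Strict Implicit.
Unset Printing Implicit Defensive.

(** * Numerical inequalities: sums of squares and binomial coefficients *)

Lemma bin2_mul2 n : 'C(n, 2) * 2 = n * n.-1.
Proof.
by elim: n => // -[|n] IHn //; rewrite binS bin1 mulnDl IHn /= -mulnDr addn2 mulnC.
Qed.

(** Two-term case of [sum_sqr_gt_seq]; the bound 7 leaves finitely many triples [e1], [e2], [b]. *)
Lemma sum_sqr_gt2 (b e1 e2 t1 t2 : nat) :
    1 < e1 -> 1 < e2 -> e1 + b + (e2 + b) <= b + 7 ->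
    t1 * 2 <= e1 * e1.-1 -> t2 * 2 <= e2 * e2.-1 ->
  (t1 + e1 + b) + (t2 + e2 + b) + (t1 + t2 + b + 2) * (t1 + t2 + b)
    < (t1 + e1 + b) ^ 2 + (t2 + e2 + b) ^ 2.
Proof.
move=> h1 h2 h3 le1 le2.
(* For numerical e1, e2 and b, these two bounds make the goal linear. *)
have le12 : t1 * t2 * 2 <= t1 * (e2 * e2.-1) by rewrite -mulnA leq_mul2l le2 orbT.
have le21 : t1 * t2 * 2 <= t2 * (e1 * e1.-1).
  by rewrite [t1 * _]mulnC -mulnA leq_mul2l le1 orbT.
rewrite -!mulnn.
have : e1 <= 5 by lia.
have : e2 <= 5 by lia.
have : b <= 3 by lia.
case: b h3 => [|[|[|[|b]]]] //; case: e1 h1 le1 le21 => [|[|[|[|[|[|e1]]]]]] //;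
case: e2 h2 le2 le12 => [|[|[|[|[|[|e2]]]]]] //=; lia.
Qed.

Lemma sum_sqr_gt3 (e1 e2 e3 t1 t2 t3 : nat) :
    1 < e1 -> 1 < e2 -> 1 < e3 -> e1 + (e2 + e3) <= 7 ->
    t1 * 2 <= e1 * e1.-1 -> t2 * 2 <= e2 * e2.-1 -> t3 * 2 <= e3 * e3.-1 ->
  (t1 + e1) + (t2 + e2 + (t3 + e3)) + (t1 + (t2 + t3) + 2) * (t1 + (t2 + t3))
    < (t1 + e1) ^ 2 + ((t2 + e2) ^ 2 + (t3 + e3) ^ 2).
Proof.
move=> h1 h2 h3 le7 le1 le2 le3.
have lem x y e : y * 2 <= e * e.-1 -> x * y * 2 <= x * (e * e.-1).
  by rewrite -mulnA leq_mul2l orbC => ->.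
have l12 := lem t1 _ _ le2; have l13 := lem t1 _ _ le3; have l23 := lem t2 _ _ le3.
have l21 := lem t2 _ _ le1; have l31 := lem t3 _ _ le1; have l32 := lem t3 _ _ le2.
rewrite -!mulnn; clear lem.
have : e1 <= 3 by lia.
have : e2 <= 3 by lia.
have : e3 <= 3 by lia.
case: e1 h1 le1 l21 l31 le7 => [|[|[|[|e1]]]] //;
case: e2 h2 le2 l12 l32 => [|[|[|[|e2]]]] //;
case: e3 h3 le3 l13 l23 => [|[|[|[|e3]]]] //=; lia.
Qed.

(** Each [e i + b] is at least [b + 2] and their sum is at most [b + 7], so there are at most three
    terms, and three terms force [b = 0]. *)
Lemma sum_sqr_gt_seq (I : eqType) (s : seq I) (b : nat) (t e : I -> nat) :
    s != [::] ->
    {in s, forall i, 1 < e i} -> {in s, forall i, t i * 2 <= e i * (e i).-1} ->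
    \sum_(i <- s) (e i + b) <= b + 7 ->
    let T := \sum_(i <- s) t i in
  \sum_(i <- s) (t i + e i + b) + (T + b + 2) * (T + b)
    < \sum_(i <- s) (t i + e i + b) ^ 2.
Proof.
move=> s0 e2 te sum_e /=.
case: s s0 e2 te sum_e => [|i [|j [|k [|l s]]]] // _ e2 te.
- rewrite !big_seq1 -mulnn; have /e2 := mem_head i [::]; clear; nia.
- rewrite !big_cons !big_nil !addn0 => le7.
  by apply: sum_sqr_gt2; rewrite ?e2 ?te // !inE eqxx ?orbT.
- rewrite !big_cons !big_nil !addn0.
  have [ei ej ek] : [/\ 1 < e i, 1 < e j & 1 < e k].
    by split; apply: e2; rewrite !inE eqxx ?orbT.
  move=> le7; have b0 : b = 0 by move: ei ej ek le7; clear; lia.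
  subst b; rewrite !addn0 in le7 *.
  by apply: sum_sqr_gt3; rewrite ?te // !inE eqxx ?orbT.
- rewrite !big_cons.
  have [] : [/\ 1 < e i, 1 < e j, 1 < e k & 1 < e l].
    by split; apply: e2; rewrite !inE eqxx ?orbT.
  clear; lia.
Qed.

(** To be applied to the cosets C of H in SH, with [a] = |A|, [w] = |W :&: C|, [t] the number of
    points of C outside AS, and [d] a number of chains. The quantity [e i = w i - t i - (a - 3)] is
    at least [d + 1], whence [t i <= 'C(e i, 2)]; the cosets with [t i = 0] only need
    [w i <= w i ^ 2]. *)
Lemma sum_sqr_gt (I : finType) (P : pred I) (a : nat) (t w : I -> nat) :
    2 < a ->
    (forall i, P i -> 0 < t i ->
       exists2 d, t i + d + a <= w i + 2 & t i <= 'C(d.+1, 2)) ->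
    (forall i, P i -> t i <= w i) ->
    \sum_(i | P i) w i <= \sum_(i | P i) t i + a + 4 ->
    0 < \sum_(i | P i) t i ->
    let T := \sum_(i | P i) t i in
  \sum_(i | P i) w i + (T + a - 1) * (T + a - 3) < \sum_(i | P i) w i ^ 2.
Proof.
move=> gta2 tw_pos tw; rewrite /=; set b := a - 3.
pose Q i := P i && (0 < t i); pose s := enum Q; pose e i := w i - t i - b.
have sumQ f : \sum_(i <- s) f i = \sum_(i | P i && (0 < t i)) f i.
  by rewrite big_enum.
have sP i : i \in s ->
    [/\ w i = t i + e i + b, 1 < e i & t i * 2 <= e i * (e i).-1].
  rewrite mem_enum => /andP[Pi ti]; have [d le_d] := tw_pos i Pi ti.
  move=> le_t; have le_t2 : t i * 2 <= d.+1 * d.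
    by rewrite -(bin2_mul2 d.+1) leq_mul2r le_t orbT.
  have d_gt0 : 0 < d by move: le_t2 ti; clear; case: d; lia.
  have le_de : d.+1 <= e i by rewrite /e /b; move: le_d gta2; clear; lia.
  split; first by rewrite /e /b; move: le_d d_gt0 gta2; clear; lia.
    exact: leq_trans le_de.
  by apply: leq_trans le_t2 _; rewrite leq_mul // -ltnS (leq_trans le_de) // leqSpred.
have sum_t : \sum_(i | P i) t i = \sum_(i <- s) t i.
  rewrite sumQ (bigID (fun i => 0 < t i)) /= [X in _ + X]big1 ?addn0 // => i.
  by rewrite lt0n negbK => /andP[_ /eqP].
have split_w (f : I -> nat) : \sum_(i | P i) f i
    = \sum_(i <- s) f i + \sum_(i | P i && ~~ (0 < t i)) f i.
  by rewrite sumQ -bigID.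
have sum_sqr_rest : \sum_(i | P i && ~~ (0 < t i)) w i
    <= \sum_(i | P i && ~~ (0 < t i)) w i ^ 2.
  by apply: leq_sum => i _; rewrite -mulnn; case: (w i) => // n; rewrite leq_pmulr.
rewrite sum_t (split_w w) (split_w (fun i => w i ^ 2)) => le_sum t_gt0.
have s0 : s != [::] by apply: contraTneq t_gt0 => ->; rewrite big_nil.
have sum_w : \sum_(i <- s) w i = \sum_(i <- s) t i + \sum_(i <- s) (e i + b).
  by rewrite -big_split; apply: eq_big_seq => i /sP[-> _ _]; rewrite /= addnA.
have le7 : \sum_(i <- s) (e i + b) <= b + 7.
  move: le_sum; rewrite sum_w /b; move: gta2; clear; lia.
have e_gt1 : {in s, forall i, 1 < e i} by move=> i /sP[].
have t_le : {in s, forall i, t i * 2 <= e i * (e i).-1} by move=> i /sP[].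
have := sum_sqr_gt_seq s0 e_gt1 t_le le7.
have -> : \sum_(i <- s) (t i + e i + b) = \sum_(i <- s) w i.
  by apply: eq_big_seq => i /sP[<-].
have -> : \sum_(i <- s) (t i + e i + b) ^ 2 = \sum_(i <- s) w i ^ 2.
  by apply: eq_big_seq => i /sP[<-].
rewrite /=.
have -> : \sum_(i <- s) t i + b + 2 = \sum_(i <- s) t i + a - 1.
  by rewrite /b; move: gta2; clear; lia.
have -> : \sum_(i <- s) t i + b = \sum_(i <- s) t i + a - 3.
  by rewrite /b; move: gta2; clear; lia.
move: sum_sqr_rest; clear; lia.
Qed.

(** Final estimate, with [t] = |T|, [a] = |A|, [n] = m and [d] chains. Equality holds for [a = 3],
    [d = n + 2], [t = 'C(d + 1, 2)]. *)
Lemma bin2_bound (n d t a : nat) :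
    2 < a -> a <= t -> d <= n + 2 ->
    t = d \/ a <= d.+1 /\ t <= d + 'C(d + 3 - a, 2) ->
  t + n + a <= 'C(n + 4, 2).
Proof.
move=> gta2 le_at le_dn alt; rewrite -(leq_pmul2r (ltn0Sn 1)) bin2_mul2.
case: alt => [eq_td | [le_ad le_t]]; first by nia.
have := leq_mul le_t (leqnn 2); rewrite mulnDl bin2_mul2.
have [u eq_d] : exists u, d = u + (a - 3) by exists (d - (a - 3)); lia.
have -> : d + 3 - a = u by lia.
have u2 : 1 < u by lia.
have le_ud : u <= d by lia.
nia.
Qed.

Local Open Scope group_scope.

(** * Counting along the cosets of a subgroup *)

Lemma card_lcosets_sum (gT : finGroupType) (H : {group gT}) (S X : {set gT}) :
  X \subset S * H -> #|X| = (\sum_(C in lcosets H S) #|X :&: C|)%N.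
Proof.
move=> sX; rewrite -sum1_card.
rewrite (partition_big (fun g => g *: H) (mem (lcosets H S))) /=; last first.
  move=> g /(subsetP sX)/mulsgP[s h Ss Hh ->].
  by apply/lcosetsP; exists s; rewrite // lcosetM lcoset_id.
apply: eq_bigr => _ /lcosetsP[s _ ->]; rewrite sum1dep_card.
apply: eq_card => g; rewrite !inE; congr (_ && _).
by apply/eqP/idP => [<- | /lcoset_eqP //]; apply: lcoset_refl.
Qed.

(** Both sides count the ordered pairs of points of W in a common left coset of H; on the left they
    are sorted by their quotient [h]. *)
Lemma sum_card_setI_rcoset (gT : finGroupType) (H : {group gT}) (S W : {set gT}) :
    W \subset S * H ->
  (\sum_(h in H) #|W :&: W :* h| = \sum_(C in lcosets H S) #|W :&: C| ^ 2)%N.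
Proof.
move=> sW.
transitivity (\sum_(h in H) \sum_(w in W) (w * h^-1 \in W)%g)%N.
  apply: eq_bigr => h _; rewrite -sum1_card.
  rewrite (eq_bigl (fun w => (w \in W) && (w * h^-1 \in W))); last first.
    by move=> w; rewrite inE mem_rcoset.
  by rewrite big_mkcondr; apply: eq_bigr => w _; case: (_ \in W).
rewrite exchange_big /=.
transitivity (\sum_(w in W) #|W :&: w *: H|)%N.
  apply: eq_bigr => w _; rewrite -sum1_card [RHS](reindex_inj (mulgI w)).
  rewrite [RHS](reindex_inj invg_inj) /= [RHS]big_mkcond [LHS]big_mkcond.
  apply: eq_bigr => h _; rewrite inE mem_lcoset mulKg groupV andbC.
  by case: (h \in H) => //; case: (_ \in W).
rewrite (partition_big (fun g => g *: H) (mem (lcosets H S))) /=; last first.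
  move=> g /(subsetP sW)/mulsgP[s h Ss Hh ->].
  by apply/lcosetsP; exists s; rewrite // lcosetM lcoset_id.
apply: eq_bigr => _ /lcosetsP[s _ ->].
transitivity (\sum_(i in W :&: s *: H) #|W :&: s *: H|)%N.
  apply: eq_big => [g | g /andP[_ /eqP-> //]].
  rewrite inE; congr (_ && _).
  by apply/eqP/idP => [<- | /lcoset_eqP //]; apply: lcoset_refl.
by rewrite sum_nat_const mulnn.
Qed.

(** * Chains in a set closed under lines *)

Section Lines.

Variable gT : finGroupType.
Implicit Types (A T : {set gT}) (a b c p q x y : gT).

(** The lines are the translates [q * A^-1], indexed by [q], which lies on its own line when A
    contains 1. *)
Definition line_closed A T := forall q a b c,
  a \in A -> b \in A -> c \in A -> a != b ->
  q * a^-1 \in T -> q * b^-1 \in T -> q * c^-1 \in T.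

Definition coset_free A T :=
  forall p, p \in T -> exists2 h, h \in <<A>> & p * h \notin T.

(* The first points of the maximal chains p, p x, p x^2, ... inside T; inner x T
   is T without them, and isolated x T consists of the chains of length 1. *)
Definition starts x T := T :\: T :* x.
Definition inner x T := T :&: T :* x.
Definition isolated x T := [set p in T | (p * x^-1 \notin T) && (p * x \notin T)].

Lemma mem_starts x T p : (p \in starts x T) = (p * x^-1 \notin T) && (p \in T).
Proof. by rewrite inE mem_rcoset. Qed.

Lemma mem_inner x T p : (p \in inner x T) = (p \in T) && (p * x^-1 \in T).
Proof. by rewrite inE mem_rcoset. Qed.

Lemma card_starts_inner x T : #|T| = #|starts x T| + #|inner x T|.
Proof. by rewrite addnC /starts /inner cardsID. Qed.

Lemma coset_free_sub A T T' : T' \subset T -> coset_free A T -> coset_free A T'.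
Proof.
move=> sT'T freeT p /(subsetP sT'T)/freeT[h Hh phT]; exists h => //.
by apply: contra phT; apply: (subsetP sT'T).
Qed.

(** Deleting the first points destroys the chains of length 1, while every other chain with a start
    survives with its start moved by [x]. *)
Lemma card_starts_inner_isolated x T :
  #|starts x (inner x T)| + #|isolated x T| <= #|starts x T|.
Proof.
rewrite -(card_rcoset _ x^-1) -cardsUI.
set I := _ :&: isolated x T; have -> : I = set0.
  apply/setP => p; rewrite in_setI mem_rcoset invgK mem_starts mem_inner mulgK !inE.
  by case: (p * x \in T); rewrite ?andbF.
rewrite cards0 addn0; apply/subset_leq_card/subsetP => p.
rewrite in_setU mem_rcoset !mem_starts !mem_inner invgK mulgK inE.
by case: (p \in T); case: (p * x^-1 \in T); case: (p * x \in T).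
Qed.

Section Fixed.

Variable A : {set gT}.
Hypotheses (A1 : 1 \in A) (abelA : {in A &, forall a b, commute a b}).

Lemma line_closed_inner x T :
  x \in A -> line_closed A T -> line_closed A (inner x T).
Proof.
move=> Ax clT q a b c Aa Ab Ac neq_ab.
have move_x d : d \in A -> q * d^-1 * x^-1 = q * x^-1 * d^-1.
  by move=> Ad; rewrite -!mulgA -!invMg (abelA Ax Ad).
rewrite !mem_inner !move_x // => /andP[Ta Ta'] /andP[Tb Tb'].
by rewrite (clT q a b c) // (clT (q * x^-1) a b c).
Qed.

(** The line of a point [q] of T contains [q] and [q * x^-1], hence lies in T. So each element of A
    stabilizes the finite set T by right translation, and so does <<A>>. *)
Lemma line_closed_stable x T p h :
    x \in A -> x != 1 -> line_closed A T ->
    (forall q, q \in T -> q * x^-1 \in T) ->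
  p \in T -> h \in <<A>> -> p * h \in T.
Proof.
move=> Ax x1 clT stT Tp Hh.
have stA a q : a \in A -> q \in T -> q * a^-1 \in T.
  move=> Aa Tq; apply: (clT q 1 x a) => //; first by rewrite eq_sym.
    by rewrite invg1 mulg1.
  exact: stT.
have: <<A>> \subset 'C[T | 'Rs].
  rewrite gen_subG; apply/subsetP => a Aa; apply/astab1P.
  rewrite /= rcosetE; apply/eqP; rewrite eq_sym eqEcard card_rcoset leqnn andbT.
  by apply/subsetP => q Tq; rewrite mem_rcoset stA.
move/subsetP/(_ h Hh)/astab1P => /= <-.
by rewrite rcosetE mem_rcoset mulgK.
Qed.

(** If no chain had length 1, the shift by [x * y^-1] would send starts to starts, and by induction
    every chain with a start could be prolonged forever, which the finite order of [x] forbids. *)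
Lemma isolated_exists x y T :
    x \in A -> y \in A -> x != 1 -> y != 1 -> x != y -> line_closed A T ->
  starts x T != set0 -> isolated x T != set0.
Proof.
move=> Ax Ay x1 y1 xy clT; case/set0Pn=> p0 Sp0.
apply/negP => /eqP iso0.
have next p : p \in starts x T -> p * x \in T.
  rewrite mem_starts => /andP[npx Tp]; apply/negPn/negP => npx'.
  by have:= in_set0 p; rewrite -iso0 inE Tp npx npx'.
have cxy : commute x y by exact: abelA.
have step p : p \in starts x T -> p * x * y^-1 \in starts x T.
  move=> Sp; have Tpx := next p Sp.
  move: Sp; rewrite !mem_starts => /andP[npx Tp].
  apply/andP; split; last first.
    apply: (clT (p * x) 1 x y); rewrite ?mulgK ?invg1 ?mulg1 //.
    by rewrite eq_sym.
  have -> : p * x * y^-1 * x^-1 = p * y^-1.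
    by rewrite -!mulgA -invMg cxy invMg mulKVg.
  apply: contra npx => Tpy.
  apply: (clT p 1 y x); rewrite ?invg1 ?mulg1 //.
  by rewrite eq_sym.
(* The points of index [j] in the chains of [p] and of [p * x * y^-1] are two points of the line of
   [p * x ^+ j.+1], so the latter is in T. *)
have climb j p : p \in starts x T -> p * x ^+ j \in T.
  elim: j p => [|j IHj] p Sp.
    by move: Sp; rewrite expg0 mulg1 mem_starts => /andP[].
  have Tq: p * x ^+ j.+1 * y^-1 \in T.
    have cyx : commute y^-1 (x ^+ j) by apply/commuteX/commute_sym/commuteV.
    by rewrite expgS -!mulgA -cyx !mulgA IHj ?step.
  rewrite -[_ * _]mulg1 -invg1; apply: (clT _ x y) => //.
  by rewrite expgSr mulgA mulgK IHj.
have := climb #[x].-1 p0 Sp0.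
move: Sp0; rewrite mem_starts invg_expg => /andP[/negPf-> _] //.
Qed.

Lemma cardsD1_1 x : x \in A -> x != 1 -> #|A| = #|A :\ 1 :\ x| + 2.
Proof.
by move=> Ax x1; rewrite (cardsD1 1 A) (cardsD1 x (A :\ 1)) !inE A1 x1 Ax addnA addnC.
Qed.

Lemma isolated_gt0 x T :
    2 < #|A| -> x \in A -> x != 1 -> line_closed A T -> coset_free A T ->
  T != set0 -> 0 < #|isolated x T|.
Proof.
move=> gtA2 Ax x1 clT freeT /set0Pn[p Tp]; rewrite card_gt0.
have [y Ay /andP[y1 xy]] : exists2 y, y \in A & (y != 1) && (x != y).
  have : 0 < #|A :\ 1 :\ x| by move: gtA2; rewrite (cardsD1_1 Ax x1); lia.
  case/card_gt0P=> y; rewrite !inE => /and3P[yx y1 Ay].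
  by exists y; rewrite // y1 eq_sym.
apply: (isolated_exists (y := y)) => //.
(* Without any start, T would be stable under [x^-1] and contain the coset of [p]. *)
apply: contraPneq (freeT p Tp) => S0 [h Hh]; apply/negP/negPn.
apply: (line_closed_stable (x := x)) => // q Tq; apply/negPn/negP => nq.
by have := in_set0 q; rewrite -S0 mem_starts nq Tq.
Qed.

(** Each deletion of the first points loses at least one chain, so |T| is at most d + (d - 1) + ...
    + 1. *)
Lemma card_coset_free x T :
    2 < #|A| -> x \in A -> x != 1 -> line_closed A T -> coset_free A T ->
  #|T| <= 'C(#|starts x T|.+1, 2).
Proof.
move=> gtA2 Ax x1; have [n] := ubnP #|T|.
elim: n T => // n IHn T ltTn clT freeT.
have [-> | T0] := eqVneq T set0; first by rewrite cards0.
have i0 := isolated_gt0 gtA2 Ax x1 clT freeT T0.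
have eT := card_starts_inner x T.
have dS := card_starts_inner_isolated x T.
have /IHn : #|inner x T| < n by lia.
move/(_ (line_closed_inner Ax clT) (coset_free_sub (subsetIl _ _) freeT)) => le_inner.
rewrite eT binS bin1 addnC leq_add2r (leq_trans le_inner) // leq_bin2l //; lia.
Qed.

(** An isolated point [p] of [inner x T] ends a chain of length 2 of T; then [p * y^-1] is isolated
    in T for each [y] in A other than 1 and [x]. *)
Lemma card_isolated x T :
    2 < #|A| -> x \in A -> x != 1 -> line_closed A T -> coset_free A T ->
  inner x T != set0 -> #|A| <= #|isolated x T| + 2.
Proof.
move=> gtA2 Ax x1 clT freeT inner0.
have := isolated_gt0 gtA2 Ax x1 (line_closed_inner Ax clT)
          (coset_free_sub (subsetIl _ _) freeT) inner0.
case/card_gt0P=> p; rewrite inE !mem_inner mulgK => /and3P[/andP[Tp Tpx]].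
rewrite Tpx Tp /= andbT => nTpxx nTpx.
suff: #|[set p * y^-1 | y in A :\ 1 :\ x]| <= #|isolated x T|.
  rewrite card_imset; last by move=> y z /mulgI/invg_inj.
  by rewrite (cardsD1_1 Ax x1) // leq_add2r.
apply/subset_leq_card/subsetP => _ /imsetP[y + ->].
rewrite !inE => /and3P[yx y1 Ay]; have cxy : commute x y by exact: abelA.
have cxy' : x * y^-1 = y^-1 * x by exact: commuteV.
apply/and3P; split.
- by apply: (clT p 1 x y); rewrite ?invg1 ?mulg1 // eq_sym.
- apply: contra nTpxx => Tpyx.
  apply: (clT (p * x^-1) 1 y x); rewrite ?invg1 ?mulg1 //; first by rewrite eq_sym.
  by rewrite -mulgA -invMg -cxy invMg mulgA.
- apply: contra nTpx => Tpyx; rewrite -[_ * _]mulg1 -invg1.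
  apply: (clT _ x y); rewrite ?mulgK //; first by rewrite eq_sym.
  by rewrite -mulgA cxy' mulgA.
Qed.

(** If some chain has two points, at least |A| - 2 of the d chains have length 1 and vanish in
    [inner x T], which keeps between 1 and d + 2 - |A| chains. *)
Lemma card_coset_free_alt x T :
    2 < #|A| -> x \in A -> x != 1 -> line_closed A T -> coset_free A T ->
  #|T| = #|starts x T| \/
  #|A| <= #|starts x T|.+1 /\
  #|T| <= #|starts x T| + 'C(#|starts x T| + 3 - #|A|, 2).
Proof.
move=> gtA2 Ax x1 clT freeT; have eT := card_starts_inner x T.
have [I0 | I0] := eqVneq (inner x T) set0.
  by left; rewrite eT I0 cards0 addn0.
have clI := line_closed_inner Ax clT.
have freeI := coset_free_sub (subsetIl T (T :* x)) freeT.
have iT := card_isolated gtA2 Ax x1 clT freeT I0.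
have i1 := isolated_gt0 gtA2 Ax x1 clI freeI I0.
have dT := card_starts_inner_isolated x T.
have dI := card_starts_inner_isolated x (inner x T).
have leI := card_coset_free gtA2 Ax x1 clI freeI.
right; split; first lia.
rewrite {1}eT leq_add2l (leq_trans leI) // leq_bin2l //; lia.
Qed.

(** Three disjoint parts of T A^-1 are counted: T, the d points preceding the starts, and the |A| -
    2 points [p * y^-1] for one isolated [p]. *)
Lemma card_mul_invg x T :
    2 < #|A| -> x \in A -> x != 1 -> line_closed A T -> coset_free A T ->
  T != set0 -> #|T| + #|starts x T| + #|A| <= #|T * A^-1| + 2.
Proof.
move=> gtA2 Ax x1 clT freeT T0.
have /card_gt0P[p] := isolated_gt0 gtA2 Ax x1 clT freeT T0.
rewrite inE => /and3P[Tp npx' npx].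
set Y := [set p * y^-1 | y in A :\ 1 :\ x].
have cardY : #|A| = #|Y| + 2.
  rewrite card_imset; last by move=> y z /mulgI/invg_inj.
  by rewrite (cardsD1_1 Ax x1) // leq_add2r.
set U := T :|: (starts x T) :* x^-1.
have cardU : #|U| = #|T| + #|starts x T|.
  rewrite cardsU card_rcoset; set I := T :&: _; have -> : I = set0.
    apply/setP => q; rewrite in_setI mem_rcoset invgK mem_starts mulgK inE.
    by case: (q \in T).
  by rewrite cards0 subn0.
have cardUY : #|U :|: Y| = #|U| + #|Y|.
  rewrite cardsU; have -> : U :&: Y = set0; last by rewrite cards0 subn0.
  apply/setP => q; rewrite in_setI in_set0; apply/negP => /andP[+ /imsetP[y]].
  rewrite !inE => + /and3P[yx y1 Ay] eq_q; subst q.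
  rewrite mem_rcoset invgK mem_starts => /orP[Tpy|/andP[_ Tpyx]].
    case/negP: npx'; apply: (clT p 1 y x); rewrite ?invg1 ?mulg1 //.
    by rewrite eq_sym.
  case/negP: npx; rewrite -[_ * _]mulg1 -invg1.
  apply: (clT _ x y); rewrite ?mulgK //; first by rewrite eq_sym.
  have -> : p * x * y^-1 = p * y^-1 * x; last by [].
  by rewrite -!mulgA; congr (_ * _); apply/commuteV/abelA.
have : #|U :|: Y| <= #|T * A^-1|; last by lia.
apply/subset_leq_card/subsetP => q; rewrite !in_setU mem_rcoset invgK mem_starts.
have in_TA r a : a \in A -> r \in T -> r * a^-1 \in T * A^-1.
  by move=> Aa Tr; rewrite mem_mulg // mem_invg invgK.
case/orP=> [/orP[Tq | /andP[_ Tqx]] | /imsetP[y + ->]].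
- by rewrite -[q]mulg1 -invg1 in_TA.
- by rewrite -[q](mulgK x) in_TA.
- by rewrite !inE => /and3P[_ _ Ay]; rewrite in_TA.
Qed.
End Fixed.

End Lines.

(** * Fragments, atoms and the intersection property *)

Lemma kappa_le (gT : finGroupType) k (S X : {set gT}) :
  X \in admissible k S -> kappa k S <= excess S X.
Proof.
rewrite /kappa => admX; have := mem_index_enum X.
elim: (index_enum _) => // Y s IHs; rewrite inE big_cons => /orP[/eqP<-|sX].
  by rewrite admX geq_minl.
by case: ifP => _; [apply: leq_trans (geq_minr _ _) (IHs sX) | apply: IHs].
Qed.

Section Atom.

Variables (gT : finGroupType) (G : {group gT}) (S A : {set gT}).
Hypotheses (abelG : abelian G) (S1 : 1 \in S) (genS : <<S>> = G).
Hypothesis atomA : atom 2 S A.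

Let T := G :\: A * S.

Lemma sub_gen_S : S \subset G. Proof. by rewrite -genS subset_gen. Qed.

Lemma comG x y : x \in G -> y \in G -> x * y = y * x.
Proof. by move=> Gx Gy; apply: (centsP abelG). Qed.

Lemma leq_card_mul (X : {set gT}) : #|X| <= #|X * S|.
Proof.
apply/subset_leq_card/subsetP => x Xx; rewrite -[x]mulg1; exact: mem_mulg.
Qed.

Lemma atom_admissible : [/\ A \subset G, 1 < #|A| & #|A * S| + 2 <= #|G|].
Proof.
by case/andP: atomA => /andP[+ _] _; rewrite inE genS => /and3P[].
Qed.

Lemma kappa_atom : kappa 2 S + #|A| = #|A * S|.
Proof.
case/andP: atomA => /andP[_ /eqP <-] _; rewrite /excess subnK //.
exact: leq_card_mul.
Qed.

Lemma atom_le (X : {set gT}) : X \subset G -> 1 < #|X| -> #|X * S| + 2 <= #|G| ->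
  #|A * S| + #|X| <= #|X * S| + #|A|.
Proof.
move=> sXG X2 XS2; have admX : X \in admissible 2 S.
  by rewrite inE genS sXG X2.
have := kappa_le admX; rewrite /excess.
have := leq_card_mul X; have := kappa_atom; clear; lia.
Qed.

(** Equality would make X a fragment smaller than the atom. *)
Lemma atom_lt (X : {set gT}) : X \subset G -> 1 < #|X| -> #|X * S| + 2 <= #|G| ->
  #|X| < #|A| -> #|A * S| + #|X| < #|X * S| + #|A|.
Proof.
move=> sXG X2 XS2 ltXA; rewrite ltn_neqAle atom_le // andbT.
apply/eqP => eX; case/andP: atomA => _ /forallP/(_ X)/implyP; rewrite leqNgt ltXA.
move=> H; suff /H : fragment 2 S X by [].
rewrite /fragment inE genS sXG X2 XS2 /=; apply/eqP; rewrite /excess.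
have := leq_card_mul X; have := kappa_atom; move: eX; clear; lia.
Qed.

Lemma sub_mulAS : A * S \subset G.
Proof. by case: atom_admissible => sAG _ _; rewrite mul_subG // sub_gen_S. Qed.

Lemma card_coatom : #|T| + #|A * S| = #|G|.
Proof. by rewrite /T addnC -(cardsID (A * S) G) (setIidPr sub_mulAS). Qed.

(** T^-1 S misses A^-1, since [t^-1 * s = a^-1] would put [t = a * s] in AS. *)
Lemma coatom_inv_mul : #|T^-1 * S| + #|A| <= #|G|.
Proof.
have [sAG _ _] := atom_admissible.
have sFG : T^-1 \subset G by rewrite -invGid invSg subsetDl.
have sFSG : T^-1 * S \subset G by rewrite mul_subG // sub_gen_S.
have sA'G : A^-1 \subset G by rewrite -invGid invSg.
have I0 : (T^-1 * S) :&: A^-1 = set0.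
  apply/setP => g; rewrite in_setI in_set0.
  apply/negP => /andP[/mulsgP[t s + Ss ->]].
  rewrite !mem_invg inE => /andP[/negP nASt Gt] Ats; apply: nASt.
  have Gs := subsetP sub_gen_S s Ss; rewrite groupV in Gt.
  have -> : t^-1 = (t * s)^-1 * s; last exact: mem_mulg.
  by rewrite [RHS]comG ?groupV ?groupM // invMg mulKVg.
have := cardsUI (T^-1 * S) A^-1; rewrite I0 cards0 addn0 card_invg => <-.
by rewrite subset_leq_card // subUset sFSG.
Qed.

(** Intersection property of atoms, stated after inversion: a translate Y of A with two points in F
    = T^-1 lies in F. *)
Lemma atom_line_closed : line_closed A T.
Proof.
have [sAG A2 AS2] := atom_admissible.
have sTG : T \subset G by exact: subsetDl.
move=> q a b c Aa Ab Ac neq_ab Ta Tb.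
have Gq : q \in G.
  by rewrite -(groupMr q (groupVr (subsetP sAG a Aa))) (subsetP sTG).
set F := T^-1; set Y := q^-1 *: A.
have memF d : d \in A -> (q^-1 * d \in F) = (q * d^-1 \in T).
  by move=> Ad; rewrite mem_invg invMg invgK comG // ?groupV // (subsetP sAG).
have memI d : d \in A -> (q^-1 * d \in Y :&: F) = (q * d^-1 \in T).
  by move=> Ad; rewrite inE memF // mem_lcoset invgK mulKVg Ad.
have [leAI | ltIA] := leqP #|A| #|Y :&: F|.
  rewrite -memI //.
  have /eqP -> : Y :&: F == Y by rewrite eqEcard subsetIl card_lcoset.
  by rewrite mem_lcoset invgK mulKVg.
have sYG : Y \subset G.
  by apply/subsetP=> y; rewrite mem_lcoset invgK => /(subsetP sAG); rewrite groupMl.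
have sFG : F \subset G by rewrite -invGid invSg.
have I2 : 1 < #|Y :&: F|.
  apply/card_gt1P; exists (q^-1 * a), (q^-1 * b).
  by rewrite !memI // (inj_eq (mulgI _)).
have cardYS : #|Y * S| = #|A * S| by rewrite -mulgA card_lcoset.
have cardF : #|F| = #|T| by rewrite card_invg.
have sIY : (Y :&: F) * S \subset Y * S :&: F * S.
  by rewrite subsetI !mulSg ?subsetIl ?subsetIr.
have leIS := subset_leq_card sIY.
have cUI := cardsUI (Y * S) (F * S).
have cUI' := cardsUI Y F.
have cY : #|Y| = #|A| by rewrite card_lcoset.
have FS := coatom_inv_mul; rewrite -/F in FS.
have cT := card_coatom.
have ltI : #|A * S| + #|Y :&: F| < #|(Y :&: F) * S| + #|A|.
  apply: atom_lt => //; first by rewrite subIset ?sYG.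
  by apply: leq_trans AS2; rewrite leq_add2r -cardYS subset_leq_card ?mulSg ?subsetIl.
have U2 : 1 < #|Y :|: F|.
  by apply: leq_trans A2 _; rewrite -cY subset_leq_card ?subsetUl.
(* Submodularity: Y and F have excess at most kappa and Y :&: F has more, so Y :|: F, still
   admissible because |Y :&: F| is at least 2, would have excess below kappa. *)
have arith (g a' t as_ fs is_ ys i u us iys : nat) :
    us + iys = ys + fs -> is_ <= iys -> as_ + i < is_ + a' -> ys = as_ ->
    fs + a' <= g -> u + i = a' + t -> t + as_ = g -> 1 < i ->
    (us + 2 <= g -> as_ + u <= us + a') -> False by clear; lia.
have cYF : #|Y :|: F| + #|Y :&: F| = #|A| + #|T| by rewrite cUI' cY cardF.
have sUG : Y :|: F \subset G by rewrite subUset sYG.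
have leU := atom_le sUG U2; rewrite mulUg in leU.
by case: (arith _ _ _ _ _ _ _ _ _ _ _ cUI leIS ltI cardYS FS cYF cT I2 leU).
Qed.

(** Otherwise T^-1, whose excess is at most kappa, would be smaller than the atom. *)
Lemma leq_atom_coatom : #|A| <= #|T|.
Proof.
have [sAG A2 AS2] := atom_admissible.
have cT := card_coatom; have FS := coatom_inv_mul.
rewrite leqNgt; apply/negP => ltTA.
have sFG : T^-1 \subset G by rewrite -invGid invSg subsetDl.
have := atom_lt sFG; rewrite card_invg => /(_ _ _ ltTA).
have: forall g a t as_ fs, t + as_ = g -> 1 < a -> as_ + 2 <= g -> fs + a <= g ->
  (1 < t -> fs + 2 <= g -> as_ + t < fs + a) -> False by clear; lia.
by apply; [exact: cT | exact: A2 | |].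
Qed.

Lemma mul_coatom_invg : T * A^-1 \subset G :\: S.
Proof.
have [sAG A2 AS2] := atom_admissible.
apply/subsetP => _ /mulsgP[t a' Tt + ->]; rewrite mem_invg => Aa.
move: Tt; rewrite !inE => /andP[nASt Gt].
have Ga : a' \in G by rewrite -groupV (subsetP sAG).
rewrite groupM // andbT; apply: contra nASt => Sta.
have -> : t = a'^-1 * (t * a') by rewrite (comG (groupVr Ga) (groupM Gt Ga)) mulgK.
exact: mem_mulg.
Qed.

(** * The subgroup H generated by the atom: T contains no coset of H *)

Hypothesis A1 : 1 \in A.

Let H := <<A>>%G.

Lemma sub_gen_A : H \subset G.
Proof. by have [sAG _ _] := atom_admissible; rewrite gen_subG. Qed.

Lemma sub_S_mulAS : S \subset A * S.
Proof. by apply/subsetP => s Ss; rewrite -[s]mul1g mem_mulg. Qed.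

Lemma mulHS : H * S = S * H.
Proof. exact/centC/(sub_abelian_cent2 abelG sub_gen_A)/sub_gen_S. Qed.

Lemma sub_mulAS_mulSH : A * S \subset S * H.
Proof. by rewrite -mulHS mulSg ?subset_gen. Qed.

Lemma coatom_coset_facts s (C := s *: H) (T0 := (S * H :\: A * S) :&: C) :
  s \in S ->
  [/\ line_closed A T0, coset_free A T0 & T0 * A^-1 \subset (S * H :\: S) :&: C].
Proof.
have sSHG : S * H \subset G by rewrite mul_subG ?sub_gen_A ?sub_gen_S.
move=> Ss; have sT0T : T0 \subset T.
  by rewrite subIset // setSD.
have HA a : a \in A -> a \in H by exact/subsetP/subset_gen.
have sCSH : C \subset S * H by rewrite mulSg // sub1set.
have CV q a : a \in A -> (q * a^-1 \in C) = (q \in C).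
  by move=> Aa; rewrite !mem_lcoset mulgA groupMr // groupV HA.
split.
- move=> q a b c Aa Ab Ac ab Ta Tb.
  have Tc := atom_line_closed Aa Ab Ac ab (subsetP sT0T _ Ta)
               (subsetP sT0T _ Tb).
  move: Tc Ta; rewrite /T0 !inE !CV // => /andP[-> _] /andP[_ Cq].
  by rewrite Cq andbT; apply: (subsetP sCSH); rewrite CV.
(* Translation by [h^-1] leads back to [s], a point of the coset that lies in S, hence in AS. *)
- move=> p /setIP[_ /lcosetP[h Hh ->]]; exists h^-1; first by rewrite groupV.
  by rewrite mulgK !inE (subsetP sub_S_mulAS).
- apply/subsetP => g Tg.
  have : g \in G :\: S.
    by apply: (subsetP (mul_coatom_invg)); apply: (subsetP (mulSg _ sT0T)).
  have /mulsgP[t a' /setIP[_ Ct]] := Tg; rewrite mem_invg => Aa' eg.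
  have Cg : g \in C by rewrite eg -[a']invgK CV.
  by rewrite !inE Cg (subsetP sCSH) // => /andP[->].
Qed.

Lemma atom_coset_free :
    2 < #|A| -> <<A>> != A -> #|A * S| <= #|S| + #|A| + 4 -> coset_free A T.
Proof.
move=> gtA2 neqHA le_m z Tz.
apply/exists_inP; apply: contraT; rewrite negb_exists_in => /forall_inP zT.
have {}zT h : h \in H -> z * h \in T by move/zT; rewrite negbK.
have [sAG A2 AS2] := atom_admissible.
have sSG := sub_gen_S; have sHG := sub_gen_A.
have sSHG : S * H \subset G by rewrite mul_subG.
have sSSH : S \subset S * H by rewrite mulg_subl.
have ltAH : #|A| < #|H|.
  by rewrite proper_card // properEneq eq_sym neqHA subset_gen.
(* The coset [z *: H] inside T is disjoint from SH, which leaves the room that makes H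
   admissible. *)
have SH_H : #|S * H| + #|H| <= #|G|.
  rewrite -(card_lcoset H z) -cardsUI.
  have -> : S * H :&: z *: H = set0.
    apply/setP => g; rewrite in_setI in_set0; apply/negP => /andP[].
    case/mulsgP=> s h' Ss Hh' -> /lcosetP[h Hh eq_g].
    have /zT : h * h'^-1 \in H by rewrite groupMl ?groupV.
    by rewrite mulgA -eq_g mulgK !inE (subsetP sub_S_mulAS).
  rewrite cards0 addn0 subset_leq_card // subUset sSHG.
  by rewrite mul_subG // sub1set; move: Tz; rewrite inE => /andP[].
set T' := S * H :\: A * S; set W := S * H :\: S.
have cT' : #|T'| + #|A * S| = #|S * H|.
  by rewrite addnC -(cardsID (A * S) (S * H)) (setIidPr sub_mulAS_mulSH).
have cW : #|W| + #|S| = #|S * H|.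
  by rewrite addnC -(cardsID S (S * H)) (setIidPr sSSH).
have le_SH2 : #|S * H| + 2 <= #|G|.
  by apply: leq_trans SH_H; rewrite leq_add2l (leq_trans A2 (ltnW ltAH)).
have le_H : #|H| <= #|T'| + #|A|.
  have := atom_le sHG; rewrite mulHS => /(_ _ le_SH2).
  have H1 : 1 < #|H| := leq_trans A2 (ltnW ltAH).
  move=> /(_ H1); rewrite -cT'.
  have : forall t' as_ h a', as_ + h <= t' + as_ + a' -> h <= t' + a' by clear; lia.
  by apply.
(* The pair {1, h} is smaller than the atom, so [atom_lt] bounds |{1, h} S| strictly from below;
   inside SH that product avoids W :&: Wh. *)
have le_W h : h \in H -> h != 1 -> #|W :&: W :* h| + 3 <= #|T'| + #|A|.
  move=> Hh h1; set X := [set 1; h].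
  have X2 : #|X| = 2 by rewrite cards2 eq_sym h1.
  have sXH : X \subset H by rewrite subUset !sub1set group1.
  have sXSSH : X * S \subset S * H by rewrite -mulHS mulSg.
  have cX : #|W :&: W :* h| + #|X * S| <= #|S * H|.
    rewrite -cardsUI; have -> : (W :&: W :* h) :&: (X * S) = set0.
      apply/setP => g; rewrite !in_setI in_set0 mem_rcoset.
      apply/negP => /andP[/andP[/setDP[_ nSg] /setDP[_ nSgh]] /mulsgP[x s]].
      rewrite in_set2 => /orP[/eqP-> Ss eg|/eqP-> Ss eg].
        by rewrite eg mul1g Ss in nSg.
      have Gh := subsetP sHG h Hh; have Gs := subsetP sSG s Ss.
      by rewrite eg (comG Gh Gs) mulgK Ss in nSgh.
    rewrite cards0 addn0 subset_leq_card // subUset sXSSH andbT.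
    by rewrite subIset // subsetDl.
  have := atom_lt (subset_trans sXH sHG).
  rewrite X2 => /(_ isT).
  have XS2 : #|X * S| + 2 <= #|G|.
    by apply: leq_trans le_SH2; rewrite leq_add2r subset_leq_card.
  move=> /(_ XS2 gtA2) ltX; move: cX; rewrite -cT'.
  have : forall w xs t' as_ a', as_ + 2 < xs + a' -> w + xs <= t' + as_ ->
    w + 3 <= t' + a'.
    by clear; lia.
  by move=> arith; apply: arith ltX.
have [x Ax x1] : exists2 x, x \in A & x != 1.
  have /card_gt1P[x [y [Ax Ay xy]]] := A2.
  have [ex | ?] := eqVneq x 1; last by exists x.
  by exists y; rewrite // -ex eq_sym.
have abelA : {in A &, forall a b, commute a b}.
  by move=> a b Aa Ab; apply: comG; apply: (subsetP sAG).
have sT'W : T' \subset W by rewrite setDS // sub_S_mulAS.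
have sum_T' : \sum_(C in lcosets H S) #|T' :&: C| = #|T'|.
  by rewrite -card_lcosets_sum // subsetDl.
have sum_W : \sum_(C in lcosets H S) #|W :&: C| = #|W|.
  by rewrite -card_lcosets_sum // subsetDl.
have := @sum_sqr_gt _ (mem (lcosets H S)) #|A| (fun C => #|T' :&: C|)
          (fun C => #|W :&: C|) gtA2.
rewrite /= sum_T' sum_W -sum_card_setI_rcoset ?subsetDl //.
set sW := \sum_(h in H) _.
(* The term [h = 1] is |W|; each of the other |H| - 1 terms is bounded by [le_W], and their number
   by [le_H]. *)
have le_sum : sW <= #|W| + (#|T'| + #|A| - 1) * (#|T'| + #|A| - 3).
  rewrite /sW (big_setD1 1) ?group1 //=; apply: leq_add.
    by rewrite subset_leq_card ?subsetIl.
  apply: (@leq_trans (\sum_(h in H :\ 1) (#|T'| + #|A| - 3))).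
    apply: leq_sum => h; rewrite !inE => /andP[h1 Hh].
    by rewrite -(leq_add2r 3) subnK ?le_W // (leq_trans _ (le_W h Hh h1)) ?leq_addl.
  rewrite sum_nat_const leq_mul2r; apply/orP; right.
  move: le_H; rewrite (cardsD1 1 H) group1 /=.
  have : forall n m, 1 + n <= m -> n <= m - 1 by clear; lia.
  by apply.
move=> gt_sum; have: sW < sW; last by rewrite ltnn.
apply: leq_ltn_trans le_sum _; apply: gt_sum.
- move=> _ /lcosetsP[s Ss ->] t_gt0.
  have [clT0 freeT0 sT0W] := coatom_coset_facts Ss.
  exists #|starts x (T' :&: s *: H)|; last exact: (card_coset_free A1 abelA).
  have := card_mul_invg A1 abelA gtA2 Ax x1 clT0 freeT0.
  rewrite -card_gt0 => /(_ t_gt0) le_T0; apply: leq_trans le_T0 _.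
  by rewrite leq_add2r subset_leq_card.
- by move=> C _; rewrite subset_leq_card // setSI.
- move: cT' cW le_m.
  have: forall t' as_ sh w s a', t' + as_ = sh -> w + s = sh ->
    as_ <= s + a' + 4 -> w <= t' + a' + 4 by clear; lia.
  by move=> arith h1 h2; apply: arith h1 h2.
- move: le_H ltAH.
  have: forall t' h a', h <= t' + a' -> a' < h -> 0 < t' by clear; lia.
  by move=> arith; apply: arith.
Qed.

End Atom.

(** * Comparison of |G| - |S| with the binomial coefficient *)

Theorem theorem5p1 (gT : finGroupType) (G : {group gT}) (S A : {set gT})
    (m : int)
    (abelG : abelian G)
    (S1 : (1 \in S)%g)
    (genS : <<S>>%g = G :> {set gT})
    (sepS : separable 2 S)
    (cardS : 3 <= #|S|)
    (m_def : m = ((kappa 2 S)%:Z - #|S|%:Z)%R)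
    (m_le4 : (m <= 4)%R)
    (atomA : atom 2 S A)
    (A1 : (1 \in A)%g)
    (S_small : (#|S|%:Z < #|G|%:Z - (binz (m + 4) 2)%:Z)%R) :
  #|A| = 2 \/ group_set A.
Proof.
have [sAG A2 AS2] := atom_admissible genS atomA.
have kA := kappa_atom S1 atomA.
have := A2; rewrite leq_eqVlt => /orP[/eqP<-|gtA2]; first by left.
have [eA | nHA] := eqVneq <<A>> A; first by right; rewrite -eA groupP.
have abelA : {in A &, forall a b, commute a b}.
  by move=> a b Aa Ab; apply: (comG abelG); apply: (subsetP sAG).
have [x Ax x1] : exists2 x, x \in A & x != 1.
  have /card_gt1P[x [y [Ax Ay xy]]] := A2.
  have [ex | ?] := eqVneq x 1; last by exists x.
  by exists y; rewrite // -ex eq_sym.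
have freeT : coset_free A (G :\: A * S).
  apply: (atom_coset_free abelG) => //.
  rewrite -kA; move: m_le4; rewrite m_def.
  have : forall k s a : nat, (k%:Z - s%:Z <= 4)%R -> k + a <= s + a + 4.
    by clear; lia.
  by apply.
have clT := atom_line_closed abelG S1 genS atomA.
have leAT := leq_atom_coatom abelG S1 genS atomA.
have cT := card_coatom genS atomA.
have sTS := subset_leq_card (mul_coatom_invg abelG genS atomA).
have cS : #|G :\: S| + #|S| = #|G|.
  by rewrite addnC -(cardsID S G) (setIidPr (sub_gen_S genS)).
have T0 : G :\: A * S != set0.
  by rewrite -card_gt0; apply: leq_trans (ltnW A2) leAT.
have leT := card_mul_invg A1 abelA gtA2 Ax x1 clT freeT T0.
have altT := card_coset_free_alt A1 abelA gtA2 Ax x1 clT freeT.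
exfalso; have leM : #|starts x (G :\: A * S)| + #|S| <= kappa 2 S + 2.
  move: leT sTS cS cT kA.
  have : forall t d a v u s g k as_, t + d + a <= v + 2 -> v <= u -> u + s = g ->
    t + as_ = g -> k + a = as_ -> d + s <= k + 2 by clear; lia.
  by move=> arith h1 h2 h3 h4; apply: arith h1 h2 h3 h4.
(* Both cases of [altT] give at least two chains, so [leM] makes m nonnegative and [binz] an
   ordinary binomial coefficient. *)
have [n kE] : exists n, kappa 2 S = #|S| + n.
  exists (kappa 2 S - #|S|).
  move: leM altT leAT gtA2.
  have : forall t d a s k, d + s <= k + 2 ->
    t = d \/ a <= d.+1 /\ t <= d + 'C(d + 3 - a, 2) ->
    a <= t -> 2 < a -> k = s + (k - s).
    by clear; lia.
  by move=> arith h1 h2 h3 h4; apply: arith h1 h2 h3 h4.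
have nE : (m + 4)%R = (n + 4)%N.
  have : forall (m' : int) (k s n' : nat), m' = (k%:Z - s%:Z)%R -> k = s + n' ->
    (m' + 4)%R = (n' + 4)%N by clear; lia.
  by move=> arith; apply: arith m_def kE.
(* As |G| = |T| + |AS| and |AS| = kappa + |A|, the difference |G| - |S| equals |T| + m + |A|. *)
have : 'C(n + 4, 2) < #|G :\: A * S| + n + #|A|.
  move: S_small kE kA cT; rewrite nE [binz _ _]/=.
  have : forall c k s n' a t g as_ : nat, (s%:Z < g%:Z - c%:Z)%R -> k = s + n' ->
    k + a = as_ -> t + as_ = g -> c < t + n' + a by clear; lia.
  by move=> arith h1 h2 h3 h4; apply: arith h1 h2 h3 h4.
apply/negP; rewrite -leqNgt.
have le_d : #|starts x (G :\: A * S)| <= n + 2.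
  by rewrite -(leq_add2r #|S|) (leq_trans leM) // kE -addnA addnC.
exact: bin2_bound altT.
Qed.
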